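(* Let $H$ be a complex Hilbert space. For any positive invertible operator $A\in B(H)_{++}$, $$\delta_T([I],[A])=\tfrac12\ln\kappa(A).$$
   Context: $B(H)$ is the algebra of bounded operators on the complex Hilbert space $H$ (of any dimension), with operator norm $\|\cdot\|$; $B(H)_{++}$ is the set of positive invertible operators. For invertible $A$, the condition number is $\kappa(A):=\|A\|\,\|A^{-1}\|$. The Thompson metric on $B(H)_{++}$ is $d_T(A,B):=\|\log(A^{-1/2}BA^{-1/2})\|$. For $A\in B(H)_{++}$ let $[A]=\{\lambda A:\lambda>0\}$ be its ray; the projective Thompson metric on rays is $\delta_T([A],[B]):=\inf_{\lambda>0}d_T(A,\lambda B)$. $I$ is the identity operator. *)

(* Defs.v *)
From HB Require Import structures.
From mathcomp Require Import all_boot all_order all_algebra.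
From mathcomp Require Import sesquilinear.
From mathcomp Require Import complex.
From mathcomp Require Import all_classical all_reals all_analysis.

Set Implicit Arguments.
Unset Strict Implicit.
Unset Printing Implicit Defensive.

Import Order.TTheory GRing.Theory Num.Theory.
Import numFieldNormedType.Exports.

Local Open Scope classical_set_scope.
Local Open Scope ring_scope.
Local Open Scope complex_scope.

Section BoundedOperators.
Context {K : numFieldType} {H : normedModType K}.

(* For linear maps between normed spaces, bounded and continuous coincide. *)
Definition is_bounded_op : {pred (H -> H)} :=
  [pred f : H -> H | `[< linear f /\ continuous f >]].

Lemma is_bounded_opP (f : H -> H) :
  reflect (linear f /\ continuous f) (f \in is_bounded_op).
Proof. exact: asboolP. Qed.

Lemma is_bounded_op_submod : submod_closed is_bounded_op.
Proof.
split=> [|a f g /is_bounded_opP[lf cf] /is_bounded_opP[lg cg]].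
  apply/is_bounded_opP; split=> [b x y|].
    by rewrite /= scaler0 addr0.
  exact: cst_continuous.
apply/is_bounded_opP; split=> [b x y|x].
  rewrite !fctE lf lg !scalerDr !scalerA addrACA.
  by rewrite [a * b]mulrC.
by apply: cvgD; [apply: cvgZl_tmp; exact: cf|exact: cg].
Qed.

HB.instance Definition _ :=
  GRing.isSubmodClosed.Build K (H -> H) is_bounded_op is_bounded_op_submod.

End BoundedOperators.

Record bop (K : numFieldType) (H : normedModType K) := Bop {
  bop_fun :> H -> H;
  _ : bop_fun \in is_bounded_op
}.

Section Bop.
Context {K : numFieldType} {H : normedModType K}.
Local Notation BH := (bop H).

HB.instance Definition _ := [isSub for @bop_fun K H].
HB.instance Definition _ := [Choice of BH by <:].
HB.instance Definition _ := [SubChoice_isSubLmodule of BH by <:].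

Lemma bop_linear (S : BH) : linear S.
Proof. by have /is_bounded_opP[] := valP S. Qed.

Lemma bop_continuous (S : BH) : continuous S.
Proof. by have /is_bounded_opP[] := valP S. Qed.

Lemma id_bounded_op : (@idfun H) \in is_bounded_op.
Proof. by apply/is_bounded_opP; split=> // x; exact: cvg_id. Qed.

Lemma comp_bounded_op (S T : BH) : (S \o T) \in is_bounded_op.
Proof.
apply/is_bounded_opP; split=> [a x y|x]; first by rewrite /= !bop_linear.
by apply: continuous_comp; exact: bop_continuous.
Qed.

Definition bop_one : BH := Bop id_bounded_op.
Definition bop_mul (S T : BH) : BH := Bop (comp_bounded_op S T).

Lemma bopP (S T : BH) : S =1 T -> S = T.
Proof. by move=> ST; apply: val_inj; apply/funext. Qed.

Lemma bop_mulA : associative bop_mul. Proof. by move=> ? ? ?; exact: bopP. Qed.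
Lemma bop_mul1l : left_id bop_one bop_mul. Proof. by move=> ?; exact: bopP. Qed.
Lemma bop_mul1r : right_id bop_one bop_mul. Proof. by move=> ?; exact: bopP. Qed.
Lemma bop_mulDl : left_distributive bop_mul +%R.
Proof. by move=> ? ? ?; exact: bopP. Qed.
Lemma bop_mulDr : right_distributive bop_mul +%R.
Proof.
move=> S T U; apply: bopP => x /=.
by have := bop_linear S 1 (T x) (U x); rewrite !scale1r.
Qed.

(* Only a pzRingType, as 1 = 0 when H is the zero space. *)
HB.instance Definition _ := GRing.Zmodule_isPzRing.Build BH
  bop_mulA bop_mul1l bop_mul1r bop_mulDl bop_mulDr.

Definition bop_is_inverse (S T : BH) : Prop := S * T = 1 /\ T * S = 1.

Definition bop_invertible (S : BH) : Prop := exists T, bop_is_inverse S T.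

Definition bop_inv (S : BH) : BH := xget 0 [set T | bop_is_inverse S T].

Definition spectrum (S : BH) : set K :=
  [set z : K | ~ bop_invertible (S - z *: (1 : BH))].

End Bop.

Section Thompson.
Context {R : realType} {H : completeNormedModType R[i]}.
Local Notation BH := (bop H).

(* The norm of H takes its (real) values in R[i], hence the real part. *)
Definition opnorm (S : BH) : R :=
  sup [set complex.Re `|S x| | x in [set x : H | `|x| <= 1]].

Definition kappa (S : BH) : R := opnorm S * opnorm (bop_inv S).

Definition positive_op (dot : {dot H for Num.conj}) (S : BH) : Prop :=
  forall x : H, 0 <= dot (S x) x.

Definition pos_invertible (dot : {dot H for Num.conj}) : set BH :=
  [set S | positive_op dot S /\ bop_invertible S].

Definition poly_op (p : {poly R}) (S : BH) : BH :=
  \sum_(i < size p) (p`_i)%:C *: S ^+ i.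

(* Continuous functional calculus of a self-adjoint S (whose spectrum is
   real), for a real function f continuous on the spectrum of S: f(S) is the
   limit in operator norm of p_n(S), for any real polynomials p_n converging to
   f uniformly on the spectrum of S. *)
Definition is_funcalc (f : R -> R) (S T : BH) : Prop :=
  exists p : nat -> {poly R},
    (forall e : R, 0 < e -> \forall n \near \oo,
       forall t : R, spectrum S t%:C -> `|(p n).[t] - f t| < e) /\
    opnorm (poly_op (p n) S - T) @[n --> \oo] --> (0 : R).

Definition funcalc (f : R -> R) (S : BH) : BH :=
  xget 0 [set T | is_funcalc f S T].

Definition op_log (S : BH) : BH := funcalc (@ln R) S.

Definition op_invsqrt (S : BH) : BH := funcalc (fun t => t `^ (- 2^-1)) S.

Definition thompson (S T : BH) : R :=
  opnorm (op_log (op_invsqrt S * T * op_invsqrt S)).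

Definition ray (S : BH) : set BH :=
  [set l%:C *: S | l in [set l : R | 0 < l]].

(* A representative of each ray is chosen; as the Thompson metric is invariant
   under joint scaling of its arguments, the choice is immaterial. *)
Definition ray_repr (X : set BH) : BH := xget 0 X.

Definition proj_thompson (X Y : set BH) : R :=
  inf [set thompson (ray_repr X) (l%:C *: ray_repr Y) | l in [set l : R | 0 < l]].

End Thompson.

(* Main.v *)
(* Let S be self-adjoint and c = ||p(S)|| for a real polynomial p. The operator
   p(S)^2 - c^2 is not bounded below, so, splitting p^2 - c^2 over C, some
   factor S - z is not bounded below. Such a z is real, as S is self-adjoint,
   and |p(z)| = c. Hence ||p(S)|| is the maximum of |p| on the approximate point
   spectrum, which for a positive invertible A lies in [m, M] and contains
   m = ||A^-1||^-1 and M = ||A||. Therefore ||log (s A)|| is the maximum of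
   |ln s + ln m| and |ln s + ln M|, and its infimum over s > 0 is
   (ln M - ln m) / 2. *)
Require Import Defs.
From mathcomp Require Import all_boot all_order all_algebra.
From mathcomp Require Import sesquilinear complex.
From mathcomp Require Import all_classical all_reals all_analysis.
From mathcomp Require Import ring lra.
Import Order.TTheory GRing.Theory Num.Theory.
Import numFieldNormedType.Exports.
Local Open Scope ring_scope.
Local Open Scope complex_scope.

(** * Operator norm *)

(** Lower bounds are the right tool because they compose: a product of operators bounded below is
    bounded below, and a lower bound for a product passes to its right factor, with no discussion of
    ranges. The functional calculus, however, asks for uniform convergence on the whole spectrum. To
    compute the norm of a given logarithm, the easy inclusion of the approximate point spectrum in
    the spectrum suffices. Existence must also be proved, since [funcalc] falls back to 0 when no
    limit exists. For this the whole spectrum is confined to [m, M] by a Neumann series around the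
    midpoint, and the Taylor polynomials of ln at M are used: on [m, M] one has 0 <= 1 - t/M <= 1 -
    m/M < 1, so they converge uniformly. The factor s comes from the rays. The representative of [I]
    is an unspecified c I, whose inverse square root is again scalar, so only log ((l a / c) A)
    remains when a A represents [A]. *)

Section OperatorNorm.
Local Open Scope classical_set_scope.
Local Open Scope ring_scope.
Context {R : realType} {H : completeNormedModType R[i]}.
Implicit Types (S T : bop H) (x y : H).

(** The norm takes values in [R[i]], whose order is only partial; its real part brings the estimates
    into [R]. *)
Definition nrm (x : H) : R := complex.Re `|x|.

Lemma normE x : `|x| = (nrm x)%:C.
Proof. by rewrite /nrm RRe_real// normr_real. Qed.

Lemma nrm_ge0 x : 0 <= nrm x.
Proof. by rewrite -ler0c -normE. Qed.

Lemma nrm_eq0 x : (nrm x == 0) = (x == 0).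
Proof. by rewrite -(normr_eq0 x) normE -(inj_eq (@complexI R)). Qed.

Lemma nrm0 : nrm 0 = 0. Proof. by apply/eqP; rewrite nrm_eq0. Qed.

Lemma nrmN x : nrm (- x) = nrm x. Proof. by rewrite /nrm normrN. Qed.

Lemma nrmD x y : nrm (x + y) <= nrm x + nrm y.
Proof. by rewrite -lecR rmorphD/= -!normE ler_normD. Qed.

Lemma nrm_distC x y : nrm (x - y) = nrm (y - x).
Proof. by rewrite -opprB nrmN. Qed.

Lemma ler_nrmB x y : nrm x - nrm y <= nrm (x - y).
Proof. by rewrite lerBlDr -{1}(subrK y x) nrmD. Qed.

Lemma nrmZc (z : R[i]) x : nrm (z *: x) = complex.Re `|z| * nrm x.
Proof.
by rewrite {1}/nrm normrZ normE -{1}(@RRe_real _ `|z|) ?normr_real// -rmorphM.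
Qed.

Lemma nrmZ (a : R) x : nrm (a%:C *: x) = `|a| * nrm x.
Proof. by rewrite nrmZc normc_def /= expr0n/= addr0 sqrtr_sqr. Qed.

Lemma bopD S T x : (S + T) x = S x + T x. Proof. by []. Qed.
Lemma bopB S T x : (S - T) x = S x - T x. Proof. by []. Qed.
Lemma bopN S x : (- S) x = - S x. Proof. by []. Qed.
Lemma bopM S T x : (S * T) x = S (T x). Proof. by []. Qed.
Lemma bop1 x : (1 : bop H) x = x. Proof. by []. Qed.
Lemma bop0 x : (0 : bop H) x = 0. Proof. by []. Qed.
Lemma bopZ (a : R[i]) S x : (a *: S) x = a *: S x. Proof. by []. Qed.
Definition bopE := (bopB, bopD, bopN, bopM, bop1, bop0, bopZ).

Lemma bop_add S x y : S (x + y) = S x + S y.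
Proof. by have := bop_linear S 1 x y; rewrite !scale1r. Qed.

Lemma bop_zero S : S 0 = 0.
Proof. by apply: (addrI (S 0)); rewrite -bop_add !addr0. Qed.

Lemma bop_scale S a x : S (a *: x) = a *: S x.
Proof. by rewrite -[a *: x]addr0 bop_linear bop_zero addr0. Qed.

Lemma bop_opp S x : S (- x) = - S x.
Proof. by rewrite -scaleN1r bop_scale scaleN1r. Qed.

Lemma bop_scaleAl (a : R[i]) S T : a *: S * T = a *: (S * T).
Proof. exact: bopP. Qed.

Lemma bop_scaleAr (a : R[i]) S T : S * (a *: T) = a *: (S * T).
Proof. by apply: bopP => x; rewrite !bopE bop_scale. Qed.

(** Continuity at 0 gives a ball of radius e sent into the unit ball; a vector rescaled to norm e /
    2 lies strictly inside it, whence the constant 2 / e. *)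
Lemma bop_bounded S :
  exists2 M : R, 0 < M & forall x, nrm (S x) <= M * nrm x.
Proof.
have /cvgr0Pnorm_lt /(_ 1 ltr01) : S x @[x --> (0 : H)] --> (0 : H).
  by rewrite -[X in _ --> X](bop_zero S); exact: bop_continuous.
move=> /nbhs_ballP[e /= e0 he].
have eE : e = (complex.Re e)%:C by rewrite RRe_real// gtr0_real.
move: e0 he; rewrite eE ltcR; move: (complex.Re e) => {}e {eE} e0 he.
have h x : nrm x < e -> nrm (S x) <= 1.
  move=> xe; rewrite -lecR -normE ltW// he//.
  by rewrite -ball_normE/= sub0r normrN normE ltcR.
exists (2 / e) => [|x]; first by rewrite divr_gt0.
have [->|x0] := eqVneq x 0; first by rewrite bop_zero nrm0 mulr0.
have n0 : 0 < nrm x by rewrite lt_def nrm_eq0 x0 nrm_ge0.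
have := h ((e / 2 / nrm x)%:C *: x).
rewrite bop_scale !nrmZ ger0_norm; last by rewrite !divr_ge0// ltW.
rewrite divfK ?gt_eqF// => /(_ _)/wrap[]; first by lra.
rewrite -ler_pdivlMl ?divr_gt0// mulr1.
by rewrite !invfM !invrK [e^-1 * _]mulrC.
Qed.

Let unit_image S := [set complex.Re `|S x| | x in [set x : H | `|x| <= 1]]%classic.

Lemma unit_image_has_sup S : has_sup (unit_image S).
Proof.
split; first by exists (nrm (S 0)), 0 => //=; rewrite normr0 ler01.
have [M M0 hM] := bop_bounded S; exists M => _ [x /= x1 <-].
rewrite -/(nrm (S x)) (le_trans (hM x))// ler_piMr ?(ltW M0)//.
by rewrite -lecR -normE.
Qed.

Lemma opnorm_ub_unit S x : nrm x <= 1 -> nrm (S x) <= opnorm S.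
Proof.
move=> x1; apply: sup_upper_bound; first exact: unit_image_has_sup.
by exists x => //=; rewrite normE lecR.
Qed.

Lemma opnorm_ge0 S : 0 <= opnorm S.
Proof. by rewrite (le_trans (nrm_ge0 (S 0)))// opnorm_ub_unit// nrm0 ler01. Qed.

Lemma opnorm_ub S x : nrm (S x) <= opnorm S * nrm x.
Proof.
have [->|x0] := eqVneq x 0; first by rewrite bop_zero nrm0 mulr0.
have n0 : 0 < nrm x by rewrite lt_def nrm_eq0 x0 nrm_ge0.
have := @opnorm_ub_unit S ((nrm x)^-1%:C *: x).
rewrite bop_scale !nrmZ ger0_norm ?invr_ge0 ?nrm_ge0// mulVf ?gt_eqF//.
by move=> /(_ (lexx _)); rewrite mulrC ler_pdivrMr.
Qed.

Lemma opnorm_le S (c : R) :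
  0 <= c -> (forall x, nrm (S x) <= c * nrm x) -> opnorm S <= c.
Proof.
move=> c0 hc; apply: ge_sup; first by case: (unit_image_has_sup S).
move=> _ [x /= x1 <-]; rewrite -/(nrm (S x)) (le_trans (hc x))// ler_piMr//.
by rewrite -lecR -normE.
Qed.

Lemma opnormD S T : opnorm (S + T) <= opnorm S + opnorm T.
Proof.
apply: opnorm_le => [|x]; first by rewrite addr_ge0 ?opnorm_ge0.
by rewrite bopE (le_trans (nrmD _ _))// mulrDl lerD ?opnorm_ub.
Qed.

Lemma opnormM S T : opnorm (S * T) <= opnorm S * opnorm T.
Proof.
apply: opnorm_le => [|x]; first by rewrite mulr_ge0 ?opnorm_ge0.
rewrite bopE (le_trans (opnorm_ub _ _))// -mulrA.
by rewrite ler_wpM2l ?opnorm_ge0 ?opnorm_ub.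
Qed.

Lemma opnormN S : opnorm (- S) = opnorm S.
Proof.
suff h T : opnorm (- T) <= opnorm T.
  by apply/eqP; rewrite eq_le h -{1}(opprK S) h.
by apply: opnorm_le (opnorm_ge0 _) _ => x; rewrite bopE nrmN opnorm_ub.
Qed.

Lemma opnorm_distC S T : opnorm (S - T) = opnorm (T - S).
Proof. by rewrite -opprB opnormN. Qed.

Lemma ler_opnormB S T : `|opnorm S - opnorm T| <= opnorm (S - T).
Proof.
have h (U V : bop H) : opnorm U - opnorm V <= opnorm (U - V).
  by have := opnormD (U - V) V; rewrite subrK lerBlDr.
by rewrite ler_norml lerNl opprB h andbT opnorm_distC h.
Qed.

Lemma opnorm0 : opnorm (0 : bop H) = 0.
Proof.
apply/eqP; rewrite eq_le opnorm_ge0 andbT opnorm_le// => x.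
by rewrite bopE nrm0 mul0r.
Qed.

Lemma opnorm_eq0 S : opnorm S = 0 -> S = 0.
Proof.
move=> S0; apply: bopP => x; apply/eqP; rewrite bopE -nrm_eq0 eq_le nrm_ge0 andbT.
by rewrite (le_trans (opnorm_ub _ _))// S0 mul0r.
Qed.

Lemma opnormZ (a : R) S : opnorm (a%:C *: S) = `|a| * opnorm S.
Proof.
have h (b : R) T : opnorm (b%:C *: T) <= `|b| * opnorm T.
  apply: opnorm_le => [|x]; first by rewrite mulr_ge0 ?opnorm_ge0.
  by rewrite bopE nrmZ -mulrA ler_wpM2l ?opnorm_ub.
have [->|a0] := eqVneq a 0; first by rewrite scale0r opnorm0 normr0 mul0r.
apply/eqP; rewrite eq_le h/=.
have := h a^-1 (a%:C *: S).
rewrite scalerA -rmorphM mulVf// rmorph1 scale1r normfV ler_pdivlMl//.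
by rewrite normr_gt0.
Qed.

Lemma opnorm1 (x0 : H) : x0 != 0 -> opnorm (1 : bop H) = 1.
Proof.
move=> x00; apply/eqP; rewrite eq_le opnorm_le//=; last first.
  by move=> x; rewrite mul1r.
have n0 : 0 < nrm x0 by rewrite lt_def nrm_eq0 x00 nrm_ge0.
by rewrite -(ler_pM2r n0) mul1r (opnorm_ub 1 x0).
Qed.

(** Pointwise limits exist as [H] is complete. Comparing [S_ n x] with [f x] through a late index,
    which may depend on [x], gives a bound uniform in [x]; it yields both the continuity of [f] and
    the convergence in norm. *)
Lemma opnorm_complete (S_ : nat -> bop H) :
  (forall e : R, 0 < e ->
    exists N, forall n k, (N <= n)%N -> (N <= k)%N -> opnorm (S_ n - S_ k) <= e) ->
  exists T, opnorm (S_ n - T) @[n --> \oo] --> (0 : R).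
Proof.
move=> hS.
have cS x : cvgn (S_ ^~ x).
  apply/cauchy_cvgP/cauchy_ballP => e e0.
  have eE : e = (complex.Re e)%:C by rewrite RRe_real// gtr0_real.
  move: e0; rewrite eE ltcR; move: (complex.Re e) => {}e {eE} e0.
  have d0 : 0 < e / (nrm x + 1) by rewrite divr_gt0// ltr_wpDl// nrm_ge0.
  have [N hN] := hS _ d0.
  pose B := (S_ ^~ x) @` [set n | (N <= n)%N].
  exists (B, B); first by split; exists N => // n Nn; exists n.
  move=> [_ _] [/= [n Nn <-] [k Nk <-]]; rewrite -ball_normE/= normE ltcR.
  rewrite -bopB (le_lt_trans (opnorm_ub _ _))//.
  rewrite (le_lt_trans (ler_wpM2r (nrm_ge0 _) (hN _ _ Nn Nk)))//.
  by rewrite mulrAC ltr_pdivrMr ?ltr_wpDl ?nrm_ge0// ltr_pM2l// ltrDl ltr01.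
pose f x := limn (S_ ^~ x).
have cf x : S_ n x @[n --> \oo] --> f x by exact: cS.
have lf : linear f.
  move=> a x y; apply: cvg_lim => //.
  rewrite (_ : S_ ^~ _ = fun n => a *: S_ n x + S_ n y); last first.
    by apply/funext => n; rewrite bop_linear.
  by apply: cvgD; [apply: cvgZl_tmp|]; exact: cf.
have hf e : 0 < e -> exists N, forall n, (N <= n)%N ->
    forall x, nrm (S_ n x - f x) <= e * nrm x.
  move=> e0; have [N hN] := hS _ e0; exists N => n Nn x.
  apply/ler_addgt0Pr => d d0.
  have dc0 : 0 < d%:C :> R[i] by rewrite ltcR.
  have /cvgrPdist_lt/(_ _ dc0)[K _ hK] := cf x.
  have := hK (maxn N K) (leq_maxr _ _); rewrite /= -normrN opprB normE ltcR => /ltW hd.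
  rewrite -(subrKA (S_ (maxn N K) x)) (le_trans (nrmD _ _))// lerD//.
  rewrite -bopB (le_trans (opnorm_ub _ _))// ler_wpM2r ?nrm_ge0//.
  by rewrite hN// leq_maxl.
have fb : f \in is_bounded_op.
  apply/is_bounded_opP; split => // x.
  have [N hN] := hf _ ltr01; have [M M0 hM] := bop_bounded (S_ N).
  have fM y : nrm (f y) <= (1 + M) * nrm y.
    rewrite -(subrK (S_ N y) (f y)) (le_trans (nrmD _ _))// mulrDl lerD//.
    by rewrite nrm_distC hN.
  apply/cvgrPdist_lt => e e0.
  have eE : e = (complex.Re e)%:C by rewrite RRe_real// gtr0_real.
  move: e0; rewrite eE ltcR; move: (complex.Re e) => {}e {eE} e0.
  have M1 : 0 < 1 + M by rewrite addr_gt0.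
  have d0 : 0 < (e / (1 + M))%:C :> R[i] by rewrite ltcR divr_gt0.
  have := @cvgr_dist_lt _ _ _ (nbhs x) _ id x (@cvg_id _ _) _ d0.
  move=> /(_ _)/wrap[]; apply: filterS => y; rewrite !normE !ltcR.
  rewrite ltr_pdivlMr// mulrC => xy.
  have -> : f x - f y = f (x - y).
    have := lf (-1) y x; rewrite !scaleN1r => lfxy.
    by rewrite [x - y]addrC lfxy addrC.
  exact: le_lt_trans (fM _) xy.
exists (Bop fb); apply/cvgr0Pnorm_le => e e0.
have [N hN] := hf _ e0; exists N => // n /= Nn.
rewrite ger0_norm ?opnorm_ge0// opnorm_le ?(ltW e0)// => x.
by rewrite bopE hN.
Qed.

End OperatorNorm.

(** * Polynomials of an operator *)

Section PolynomialCalculus.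
Local Open Scope classical_set_scope.
Local Open Scope ring_scope.
Context {R : realType} {H : completeNormedModType R[i]}.
Implicit Types (S T : bop H) (p q : {poly R[i]}).

(** Complex coefficients are needed to split a real polynomial into linear factors. *)
Definition cpoly_op (p : {poly R[i]}) S : bop H :=
  \sum_(i < size p) p`_i *: S ^+ i.

Lemma cpoly_op_widen n p S : (size p <= n)%N ->
  cpoly_op p S = \sum_(i < n) p`_i *: S ^+ i.
Proof.
move=> pn; rewrite /cpoly_op (big_ord_widen n (fun i => p`_i *: S ^+ i))//.
rewrite big_mkcond/=; apply: eq_bigr => i _.
by case: ltnP => // pi; rewrite nth_default// scale0r.
Qed.

Lemma cpoly_opD p q S : cpoly_op (p + q) S = cpoly_op p S + cpoly_op q S.
Proof.
rewrite (@cpoly_op_widen (maxn (size p) (size q)) _ _ (size_polyD _ _)).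
rewrite (@cpoly_op_widen (maxn (size p) (size q)) p) ?leq_maxl//.
rewrite (@cpoly_op_widen (maxn (size p) (size q)) q) ?leq_maxr//.
by rewrite -big_split/=; apply: eq_bigr => i _; rewrite coefD scalerDl.
Qed.

Lemma cpoly_opZ a p S : cpoly_op (a *: p) S = a *: cpoly_op p S.
Proof.
rewrite (@cpoly_op_widen (size p) (a *: p)) ?size_scale_leq// scaler_sumr.
by apply: eq_bigr => i _; rewrite coefZ scalerA.
Qed.

Lemma cpoly_opN p S : cpoly_op (- p) S = - cpoly_op p S.
Proof. by rewrite -scaleN1r cpoly_opZ scaleN1r. Qed.

Lemma cpoly_opB p q S : cpoly_op (p - q) S = cpoly_op p S - cpoly_op q S.
Proof. by rewrite cpoly_opD cpoly_opN. Qed.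

Lemma cpoly_opC a S : cpoly_op a%:P S = a *: (1 : bop H).
Proof.
by rewrite (@cpoly_op_widen 1) ?size_polyC_leq1// big_ord1 coefC eqxx expr0.
Qed.

Lemma cpoly_opMX p S : cpoly_op (p * 'X) S = cpoly_op p S * S.
Proof.
rewrite (@cpoly_op_widen (size p).+1 (p * 'X)).
  rewrite big_ord_recl coefMX eqxx scale0r add0r mulr_suml.
  by apply: eq_bigr => i _; rewrite coefMX/= exprSr bop_scaleAl.
by have [->|p0] := eqVneq p 0; rewrite ?mul0r ?size_poly0// size_mulX.
Qed.

Lemma cpoly_opX S : cpoly_op 'X S = S.
Proof. by rewrite -['X]mul1r cpoly_opMX cpoly_opC scale1r mul1r. Qed.

Lemma cpoly_opM p q S : cpoly_op (p * q) S = cpoly_op p S * cpoly_op q S.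
Proof.
elim/poly_ind: q => [|q c IH].
  by rewrite mulr0 -[0]/(0%:P) cpoly_opC scale0r mulr0.
rewrite mulrDr mulrA !cpoly_opD !cpoly_opMX IH cpoly_opC mulrDr mulrA.
by rewrite mulrC mul_polyC cpoly_opZ bop_scaleAr mulr1.
Qed.

Lemma poly_opE (p : {poly R}) S :
  poly_op p S = cpoly_op (map_poly (real_complex R) p) S.
Proof.
rewrite (@cpoly_op_widen (size p)) ?size_poly//.
by apply: eq_bigr => i _; rewrite coef_map.
Qed.

Lemma poly_opD (p q : {poly R}) S : poly_op (p + q) S = poly_op p S + poly_op q S.
Proof. by rewrite !poly_opE rmorphD cpoly_opD. Qed.

Lemma poly_opB (p q : {poly R}) S : poly_op (p - q) S = poly_op p S - poly_op q S.
Proof. by rewrite !poly_opE rmorphB cpoly_opB. Qed.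

Lemma poly_opM (p q : {poly R}) S : poly_op (p * q) S = poly_op p S * poly_op q S.
Proof. by rewrite !poly_opE rmorphM cpoly_opM. Qed.

Lemma poly_opC (a : R) S : poly_op a%:P S = a%:C *: (1 : bop H).
Proof. by rewrite poly_opE map_polyC cpoly_opC. Qed.

Lemma poly_opX S : poly_op 'X S = S.
Proof. by rewrite poly_opE map_polyX cpoly_opX. Qed.

Lemma poly_op_scalar (p : {poly R}) (a : R) :
  poly_op p (a%:C *: (1 : bop H)) = p.[a]%:C *: (1 : bop H).
Proof.
rewrite !poly_opE; elim/poly_ind: p => [|p c IH].
  by rewrite map_poly0 horner0 scale0r -[0]/(0%:P) cpoly_opC scale0r.
rewrite rmorphD rmorphM/= map_polyX map_polyC cpoly_opD cpoly_opMX IH cpoly_opC.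
rewrite !hornerE bop_scaleAl mul1r scalerA -scalerDl.
by rewrite rmorphD rmorphM.
Qed.

End PolynomialCalculus.

(** * Operators bounded below and the Neumann series *)

Section BoundedBelow.
Local Open Scope classical_set_scope.
Local Open Scope ring_scope.
Context {R : realType} {H : completeNormedModType R[i]}.
Implicit Types (S T : bop H) (x : H).

Definition bounded_below S : Prop :=
  exists2 c : R, 0 < c & forall x, c * nrm x <= nrm (S x).

Lemma bounded_belowM S T :
  bounded_below S -> bounded_below T -> bounded_below (S * T).
Proof.
move=> [c c0 hS] [d d0 hT]; exists (c * d); first by rewrite mulr_gt0.
move=> x; rewrite bopE (le_trans _ (hS _))// -mulrA ler_wpM2l ?(ltW c0)//.
Qed.

Lemma bounded_below_divr S T : bounded_below (S * T) -> bounded_below T.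
Proof.
move=> [c c0 hST]; have [M M0 hS] := bop_bounded S.
exists (c / M) => [|x]; first by rewrite divr_gt0.
by rewrite mulrAC ler_pdivrMr// [X in _ <= X]mulrC; exact: le_trans (hST x) (hS _).
Qed.

Lemma bounded_below_scalar (a : R[i]) :
  a != 0 -> bounded_below (a *: (1 : bop H)).
Proof.
move=> a0; exists (complex.Re `|a|) => [|x]; last by rewrite !bopE nrmZc.
by rewrite -ltcR RRe_real ?normr_real// normr_gt0.
Qed.

Lemma invertible_bounded_below S : bop_invertible S -> bounded_below S.
Proof.
move=> [T [_ TS]]; apply: (@bounded_below_divr T); rewrite TS.
by rewrite -[1]scale1r; apply: bounded_below_scalar; exact: oner_neq0.
Qed.

Lemma bounded_below_gt (S : bop H) (a : R) :
  opnorm S < `|a| -> bounded_below (S - a%:C *: (1 : bop H)).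
Proof.
move=> Sa; exists (`|a| - opnorm S) => [|x]; first by rewrite subr_gt0.
rewrite !bopE nrm_distC (le_trans _ (ler_nrmB _ _))// nrmZ mulrBl lerB//.
exact: opnorm_ub.
Qed.

Lemma opnormX_le S n : opnorm (S ^+ n) <= opnorm S ^+ n.
Proof.
elim: n => [|n IH]; first by rewrite opnorm_le// => x; rewrite mul1r.
by rewrite !exprS (le_trans (opnormM _ _))// ler_wpM2l ?opnorm_ge0.
Qed.

(** The lower bound 1 - b of 1 - S turns the telescoped identity (1 - S)(G n - G k) = S^k - S^n into
    a Cauchy estimate for the partial sums [G]. *)
Lemma neumann_series S : opnorm S < 1 -> bop_invertible (1 - S).
Proof.
move=> S1; pose b := opnorm S; have b0 : 0 <= b := opnorm_ge0 S.
pose G n : bop H := \sum_(i < n) S ^+ i.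
have GS n : (1 - S) * G n = 1 - S ^+ n.
  rewrite /G; elim: n => [|n IH]; first by rewrite big_ord0 mulr0 expr0 subrr.
  by rewrite big_ord_recr/= mulrDr IH mulrBl mul1r -exprS addrA subrK.
have SG n : G n * (1 - S) = 1 - S ^+ n.
  rewrite /G; elim: n => [|n IH]; first by rewrite big_ord0 mul0r expr0 subrr.
  by rewrite big_ord_recr/= mulrDl IH mulrBr mulr1 -exprSr addrA subrK.
have b1 : 0 < 1 - b by rewrite subr_gt0.
have below x : (1 - b) * nrm x <= nrm ((1 - S) x).
  by rewrite !bopE (le_trans _ (ler_nrmB _ _))// mulrBl mul1r lerB// opnorm_ub.
have bX e : 0 < e -> exists N, forall n, (N <= n)%N -> opnorm (S ^+ n) <= e.
  move=> e0; have /cvgr0Pnorm_le/(_ _ e0)[N _ hN] :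
      b ^+ n @[n --> \oo] --> (0 : R).
    by apply: cvg_expr; rewrite ger0_norm.
  exists N => n /hN /=; rewrite ger0_norm ?exprn_ge0//; apply: le_trans.
  exact: opnormX_le.
have [|T cT] := @opnorm_complete _ _ G.
  move=> e e0; have d0 : 0 < e * (1 - b) / 2 by rewrite divr_gt0// mulr_gt0.
  have [N hN] := bX _ d0; exists N => n k /hN Nn /hN Nk.
  apply: opnorm_le (ltW e0) _ => x; rewrite -(ler_pM2l b1) (le_trans (below _))//.
  rewrite -bopM mulrBr !GS opprB addrC addrA subrK.
  rewrite (le_trans (opnorm_ub _ _))// mulrA ler_wpM2r ?nrm_ge0//.
  by rewrite (le_trans (opnormD _ _))// opnormN; lra.
(* Both one-sided identities reduce to this squeeze: their defects split into a product with
   [G n - T] and the tail [S ^+ n]. *)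
have zero U : (forall n, opnorm U <= opnorm (G n - T) * (1 + b) + b ^+ n) -> U = 0.
  move=> hU; apply: opnorm_eq0; apply/eqP; rewrite eq_le opnorm_ge0 andbT.
  have h : opnorm (G n - T) * (1 + b) + b ^+ n @[n --> \oo] --> 0 * (1 + b) + 0.
    apply: cvgD; first by apply: cvgMr_tmp.
    by apply: cvg_expr; rewrite ger0_norm.
  rewrite mul0r addr0 in h; apply: (cvgr_to_ge h).
  exact: nearW.
have l1 : opnorm (1 - S) <= 1 + b.
  by rewrite (le_trans (opnormD _ _))// opnormN lerD// opnorm_le// => x; rewrite mul1r.
exists T; split; apply/eqP; rewrite -subr_eq0; apply/eqP/zero => n.
- have -> : (1 - S) * T - 1 = (1 - S) * (T - G n) - S ^+ n.
    by rewrite mulrBr GS opprB addrA [RHS]addrAC addrK.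
  rewrite (le_trans (opnormD _ _))// opnormN lerD ?opnormX_le//.
  rewrite (le_trans (opnormM _ _))// mulrC opnorm_distC.
  by rewrite ler_wpM2l ?opnorm_ge0.
- have -> : T * (1 - S) - 1 = (T - G n) * (1 - S) - S ^+ n.
    by rewrite mulrBl SG opprB addrA [RHS]addrAC addrK.
  rewrite (le_trans (opnormD _ _))// opnormN lerD ?opnormX_le//.
  rewrite (le_trans (opnormM _ _))// opnorm_distC.
  by rewrite ler_wpM2l ?opnorm_ge0.
Qed.

End BoundedBelow.

(** * Self-adjoint operators *)

Section SelfAdjoint.
Local Open Scope classical_set_scope.
Local Open Scope ring_scope.
Context {R : realType} {H : completeNormedModType R[i]}.
Context (dot : {dot H for Num.conj}).
Hypothesis norm_dot : forall x : H, `|x| ^+ 2 = dot x x.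
Implicit Types (S T : bop H) (x y : H).

Definition selfadjoint S : Prop := forall x y, dot (S x) y = dot x (S y).

Lemma dot_nrm x : dot x x = (nrm x ^+ 2)%:C.
Proof. by rewrite -norm_dot normE rmorphXn. Qed.

Lemma dotC x y : dot x y = Num.conj (dot y x).
Proof. by rewrite hermC expr0 mul1r. Qed.

Lemma dotDl x y z : dot (x + y) z = dot x z + dot y z.
Proof. exact: linearDl. Qed.

Lemma dotDr x y z : dot x (y + z) = dot x y + dot x z.
Proof. exact: linearDr. Qed.

Lemma dotNl x y : dot (- x) y = - dot x y.
Proof. exact: linearNl. Qed.

Lemma dotNr x y : dot x (- y) = - dot x y.
Proof. exact: linearNr. Qed.

Lemma dotZl a x y : dot (a *: x) y = a * dot x y.
Proof. exact: linearZl_LR. Qed.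

Lemma dotZr a x y : dot x (a *: y) = Num.conj a * dot x y.
Proof. exact: linearZr_LR. Qed.

Lemma conj_real (a : R) : Num.conj a%:C = a%:C.
Proof. by apply: conj_Creal; apply/complex_realP; exists a. Qed.

(** Polarization over the complex scalars: the defect [D] vanishes on the diagonal, so D x y + D y x
    = 0, and replacing x by ix gives D x y - D y x = 0. *)
Lemma positive_selfadjoint S : positive_op dot S -> selfadjoint S.
Proof.
move=> S0; pose D x y := dot (S x) y - dot x (S y).
have Dxx x : D x x = 0.
  by rewrite /D [X in _ - X]dotC conj_Creal ?subrr// ger0_real.
have DD x y : D (x + y) (x + y) = D x x + D y y + (D x y + D y x).
  by rewrite /D bop_add !(dotDl, dotDr); ring.
move=> x y; apply/eqP; rewrite -subr_eq0 -/(D x y).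
have /eqP := DD x y; rewrite !Dxx !add0r eq_sym addr_eq0 => /eqP Dxy.
have /eqP := DD ('i%C *: x) y; rewrite !Dxx !add0r eq_sym.
have -> : D ('i%C *: x) y = 'i%C * D x y.
  by rewrite /D bop_scale !dotZl mulrBr.
have -> : D y ('i%C *: x) = - 'i%C * D y x.
  by rewrite /D bop_scale !dotZr complexiE conjCi mulrBr.
rewrite Dxy mulrN mulNr -opprD oppr_eq0 -mulr2n mulrn_eq0/=.
rewrite complexiE mulf_eq0 (negPf (neq0Ci _))/=.
by rewrite oppr_eq0.
Qed.

Lemma selfadjoint_poly (p : {poly R}) S :
  selfadjoint S -> selfadjoint (poly_op p S).
Proof.
move=> hS; elim/poly_ind: p => [|p c IH] x y.
  by rewrite -[0]/(0%:P) poly_opC scale0r !bop0 linear0l linear0r.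
rewrite poly_opD poly_opM poly_opX poly_opC !bopE dotDl dotDr dotZl dotZr conj_real.
congr (_ + _); rewrite IH hS -!bopM; congr (dot _ (bop_fun _ _)).
(* [S] commutes with [poly_op p S], both being polynomials in [S]. *)
by rewrite -{1 4}(poly_opX S) -!poly_opM mulrC.
Qed.

Lemma nrmB_sqr x y :
  (nrm (x - y) ^+ 2)%:C = dot x x + dot y y - (dot x y + dot y x).
Proof. by rewrite -dot_nrm !(dotDl, dotDr, dotNl, dotNr); ring. Qed.

(* For z = a + ib, |(S - z) x|^2 = |(S - a) x|^2 + b^2 |x|^2. *)
Lemma selfadjoint_nonreal_bounded_below S (z : R[i]) :
  selfadjoint S -> complex.Im z != 0 -> bounded_below (S - z *: (1 : bop H)).
Proof.
case: z => a b /= hS b0; exists `|b|; first by rewrite normr_gt0.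
move=> x; rewrite -(@ler_pXn2r _ 2)// ?nnegrE ?mulr_ge0 ?nrm_ge0//.
rewrite exprMn real_normK ?num_real// -lecR.
have -> : (S - (a +i* b)%C *: (1 : bop H)) x =
    (S x - a%:C *: x) - ('i%C * b%:C) *: x.
  by rewrite !bopE -[RHS]addrA -opprD -scalerDl {1}[(a +i* b)%C]complexE.
set u := S x - a%:C *: x.
have hu : dot u x = dot x u.
  by rewrite dotDl dotDr dotNl dotNr dotZl dotZr conj_real hS.
have hc : Num.conj ('i%C * b%:C) = - ('i%C * b%:C).
  by rewrite rmorphM/= conj_real complexiE conjCi mulNr.
have hi : ('i%C * b%:C) * ('i%C * b%:C) = - (b ^+ 2)%:C :> R[i].
  by rewrite mulrACA -!expr2 sqr_i mulN1r rmorphXn.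
rewrite nrmB_sqr !dotZl !dotZr hc hu ![- _ * _]mulNr addNr subr0.
rewrite mulrN [_ * (_ * dot x x)]mulrA hi mulNr opprK.
by rewrite !dot_nrm -rmorphM -rmorphD/= lecR lerDr sqr_ge0.
Qed.

(* With M = ||S||, |(S^2 - M^2) x|^2 <= M^4 |x|^2 - M^2 |S x|^2, so a lower bound
   c |x| on the left would give |S x|^2 <= (M^2 - c^2 / M^2) |x|^2. *)
Lemma selfadjoint_norm_approx S (x0 : H) : x0 != 0 -> selfadjoint S ->
  ~ bounded_below (S * S - (opnorm S ^+ 2)%:C *: (1 : bop H)).
Proof.
move=> x00 hS [c c0 hc]; pose M := opnorm S.
have M0 : 0 <= M := opnorm_ge0 S.
have n0 : 0 < nrm x0 by rewrite lt_def nrm_eq0 x00 nrm_ge0.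
have key x : M ^+ 2 * nrm (S x) ^+ 2 <= (M ^+ 4 - c ^+ 2) * nrm x ^+ 2.
  have h1 : nrm ((S * S - (M ^+ 2)%:C *: (1 : bop H)) x) ^+ 2 =
      nrm (S (S x)) ^+ 2 - 2 * M ^+ 2 * nrm (S x) ^+ 2 + M ^+ 4 * nrm x ^+ 2.
    have e1 : dot (S (S x)) x = dot (S x) (S x) by rewrite hS.
    have e2 : dot x (S (S x)) = dot (S x) (S x) by rewrite -hS.
    apply: complexI; rewrite !bopE nrmB_sqr !(dotZl, dotZr) conj_real e1 e2.
    by rewrite !dot_nrm -!rmorphM -!rmorphD -rmorphB; congr (_%:C); ring.
  have h2 := hc x; rewrite -/M in h2.
  have h3 : nrm (S (S x)) ^+ 2 <= M ^+ 2 * nrm (S x) ^+ 2.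
    by rewrite -exprMn lerXn2r ?nnegrE ?mulr_ge0 ?nrm_ge0// opnorm_ub.
  have h4 : (c * nrm x) ^+ 2 <= nrm ((S * S - (M ^+ 2)%:C *: (1 : bop H)) x) ^+ 2.
    by rewrite lerXn2r ?nnegrE ?mulr_ge0 ?nrm_ge0 ?(ltW c0).
  by move: h4; rewrite h1 exprMn; lra.
(* The bound [K2] divides by M^2. If M = 0, [key] at [x0] already says 0 <= - c^2 |x0|^2. *)
have [Mz|Mz] := eqVneq M 0.
  have := key x0; rewrite Mz !expr0n/= mul0r sub0r mulNr oppr_ge0.
  by apply/negP; rewrite -ltNge mulr_gt0// exprn_gt0.
have Mp : 0 < M by rewrite lt_def Mz.
have M2 : 0 < M ^+ 2 by rewrite exprn_gt0.
pose K2 := M ^+ 2 - c ^+ 2 / M ^+ 2.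
have key2 x : nrm (S x) ^+ 2 <= K2 * nrm x ^+ 2.
  rewrite -(ler_pM2l M2) (le_trans (key x))// [M ^+ 2 * (K2 * _)]mulrA.
  rewrite ler_wpM2r ?sqr_ge0//.
  by rewrite /K2 mulrBr [M ^+ 2 * (_ / _)]mulrC divfK ?gt_eqF// -exprD.
have K20 : 0 <= K2.
  have := le_trans (sqr_ge0 _) (key2 x0).
  by rewrite pmulr_lge0// exprn_gt0.
have : M <= Num.sqrt K2.
  apply: opnorm_le => [|x]; first exact: sqrtr_ge0.
  rewrite -(@ler_pXn2r _ 2)// ?nnegrE ?mulr_ge0 ?sqrtr_ge0 ?nrm_ge0//.
  by rewrite exprMn sqr_sqrtr.
rewrite -(@ler_pXn2r _ 2)// ?nnegrE ?sqrtr_ge0// sqr_sqrtr//.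
by rewrite /K2 lerBrDr gerDl leNgt divr_gt0// exprn_gt0.
Qed.

(** [R[i]] is algebraically closed, so linear factors split off until a nonzero constant remains.
    Used in contrapositive form, to find a root z for which S - z is not bounded below. *)
Lemma cpoly_bounded_below (p : {poly R[i]}) S : p != 0 ->
  (forall z, root p z -> bounded_below (S - z *: (1 : bop H))) ->
  bounded_below (cpoly_op p S).
Proof.
have [n] := ubnP (size p); elim: n p => // n IH p pn p0 hp.
have [/eqP p1|/closed_rootP[z pz]] := boolP (size p == 1).
  have pE := size1_polyC (eq_leq p1); rewrite pE cpoly_opC.
  by apply: bounded_below_scalar; move: p0; rewrite {1}pE polyC_eq0.
have /factor_theorem[q pE] := pz.
have q0 : q != 0 by apply: contra_neq p0 => q0; rewrite pE q0 mul0r.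
rewrite pE cpoly_opM; apply: bounded_belowM.
  apply: IH => // [|y qy].
    by move: pn; rewrite pE size_Mmonic ?monicXsubC// size_XsubC addn2.
  by apply: hp; rewrite pE rootM qy.
by rewrite cpoly_opB cpoly_opX cpoly_opC; exact: hp.
Qed.

(** Real points only: for self-adjoint [S] the approximate point spectrum has no others, by
    [selfadjoint_nonreal_bounded_below]. *)
Definition approx_spectrum S : set R :=
  [set t | ~ bounded_below (S - t%:C *: (1 : bop H))].

Lemma approx_spectrum_poly_norm (p : {poly R}) S (x0 : H) :
  x0 != 0 -> selfadjoint S ->
  exists2 t, approx_spectrum S t & `|p.[t]| = opnorm (poly_op p S).
Proof.
move=> x00 hS.
have main (q : {poly R}) : q * q - (opnorm (poly_op q S) ^+ 2)%:P != 0 ->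
    exists2 t, approx_spectrum S t & `|q.[t]| = opnorm (poly_op q S).
  move=> q0; apply: contrapT => /forall2NP h.
  apply: (selfadjoint_norm_approx _ _ x00 (selfadjoint_poly q S hS)).
  rewrite -poly_opM -(poly_opC _ S) -poly_opB poly_opE.
  apply: cpoly_bounded_below; first by rewrite map_poly_eq0.
  move=> z; have [z0|z0] := eqVneq (complex.Im z) 0; last first.
    by move=> _; exact: selfadjoint_nonreal_bounded_below.
  have -> : z = (complex.Re z)%:C by case: z z0 => a b /= ->.
  rewrite fmorph_root => /rootP; rewrite !hornerE => /eqP.
  rewrite subr_eq0 -expr2 => /eqP qt.
  case: (h (complex.Re z)) => [/contrapT//|[]].
  by rewrite -sqrtr_sqr qt sqrtr_sqr ger0_norm ?opnorm_ge0.
(* If p^2 is the constant c^2, there is no root to find, but |p| equals c everywhere and any point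
   of the approximate spectrum will do. The polynomial 'X supplies one, as X^2 - c^2 is never 0. *)
have [/eqP p0|/main//] := eqVneq (p * p - (opnorm (poly_op p S) ^+ 2)%:P) 0.
have [|t tS _] := main 'X.
  rewrite -expr2 poly_opX -size_poly_eq0 size_polyDl ?size_polyXn//.
  by rewrite size_polyN (leq_ltn_trans (size_polyC_leq1 _)).
exists t => //; move: p0; rewrite subr_eq0 => /eqP /(congr1 (horner^~ t)).
rewrite !hornerE -expr2 => pt.
by rewrite -sqrtr_sqr pt sqrtr_sqr ger0_norm ?opnorm_ge0.
Qed.

(** If |p(t)| exceeded the norm of p(S), then p(S) - p(t) would be bounded below, and with it its
    right factor S - t. *)
Lemma approx_spectrum_poly_le (p : {poly R}) S t :
  approx_spectrum S t -> `|p.[t]| <= opnorm (poly_op p S).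
Proof.
move=> tS; rewrite leNgt; apply/negP => /bounded_below_gt; apply: contra_not tS.
have /factor_theorem[q pE] : root (p - (p.[t])%:P) t.
  by apply/rootP; rewrite !hornerE subrr.
rewrite -(poly_opC _ S) -poly_opB pE poly_opM poly_opB poly_opX poly_opC.
exact: bounded_below_divr.
Qed.

End SelfAdjoint.

(** * Polynomial approximation of the logarithm *)

Section LogApproximation.
Local Open Scope classical_set_scope.
Local Open Scope ring_scope.
Context {R : realType}.

(* Taylor polynomial of ln at c. *)
Definition ln_poly (c : R) (n : nat) : {poly R} :=
  (ln c)%:P - \sum_(k < n) (k.+1%:R)^-1 *: (1 - c^-1 *: 'X) ^+ k.+1.

(** Differentiation cancels the coefficients 1/(k+1) and leaves a geometric sum of ratio 1 - t/c. *)
Lemma deriv_ln_poly (c : R) (n : nat) (t : R) : 0 < c -> 0 < t ->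
  (ln_poly c n)^`().[t] = t^-1 - (1 - t / c) ^+ n / t.
Proof.
move=> c0 t0; rewrite /ln_poly derivB derivC sub0r linear_sum hornerN horner_sum.
have -> : \sum_(i < n) (i.+1%:R^-1 *: (1 - c^-1 *: 'X) ^+ i.+1)^`().[t] =
    - (c^-1 * \sum_(i < n) (1 - t / c) ^+ i).
  rewrite mulr_sumr -sumrN; apply: eq_bigr => i _.
  rewrite derivZ deriv_exp derivB -polyC1 derivC derivZ derivX sub0r/=.
  rewrite !(hornerE, hornerMn) -[(_ * _) *+ _]mulr_natl mulrA mulVf ?pnatr_eq0//.
  by rewrite mul1r mulNr [c^-1 * t]mulrC.
rewrite opprK; transitivity ((1 - (1 - t / c) ^+ n) / t); last first.
  by rewrite mulrBl mul1r.
rewrite -[1 - _ ^+ n]opprB subrX1 [1 - t / c - 1]addrAC subrr sub0r !mulNr opprK.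
by rewrite mulrAC [t / c]mulrC mulfK ?gt_eqF.
Qed.

(* The derivative of ln_poly M n - ln at x is - (1 - x / M)^n / x, which is
   uniformly small on [m, M]; the two functions agree at M. *)
Lemma ln_poly_approx (m M : R) : 0 < m -> m <= M ->
  forall e : R, 0 < e -> \forall n \near \oo,
    forall t, m <= t <= M -> `|(ln_poly M n).[t] - ln t| < e.
Proof.
move=> m0 mM e e0; have M0 : 0 < M := lt_le_trans m0 mM.
pose r := 1 - m / M.
have r0 : 0 <= r by rewrite subr_ge0 ler_pdivrMr// mul1r.
have r1 : r < 1 by rewrite gtrBl divr_gt0.
(* The mean value theorem will bound the error by r^n (M - m) / m; the added 1 keeps the divisor
   positive when m = M. *)
pose d := e * m / (M - m + 1).
have Mm1 : 0 < M - m + 1 by rewrite ltr_wpDl// subr_ge0.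
have d0 : 0 < d by rewrite divr_gt0// mulr_gt0.
have /cvgr0Pnorm_lt/(_ _ d0) : r ^+ n @[n --> \oo] --> (0 : R).
  by apply: cvg_expr; rewrite ger0_norm.
apply: filterS => n; rewrite ger0_norm ?exprn_ge0// => rn t /andP[mt tM].
have t0 : 0 < t := lt_le_trans m0 mt.
pose g x := (ln_poly M n).[x] - ln x.
have gM : g M = 0.
  rewrite /g /ln_poly hornerD hornerN hornerC horner_sum big1 ?subr0 ?subrr// => i _.
  by rewrite !hornerE mulVf ?gt_eqF// subrr expr0n/= mulr0.
have dg (x : R) : 0 < x -> is_derive x 1 g (- ((1 - x / M) ^+ n / x)).
  move=> x0.
  have <- : (ln_poly M n)^`().[x] - x^-1 = - ((1 - x / M) ^+ n / x).
    by rewrite deriv_ln_poly// addrAC subrr sub0r.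
  by apply: is_deriveB; exact: is_derive1_ln.
have [||c cI] := @MVT_segment R g (fun x => - ((1 - x / M) ^+ n / x)) t M tM.
- by move=> x; rewrite in_itv/= => /andP[tx _]; apply: dg; exact: lt_trans tx.
- apply: derivable_within_continuous => x; rewrite in_itv/= => /andP[tx _].
  by have [] := dg x (lt_le_trans t0 tx).
rewrite gM sub0r => /eqP; rewrite eqr_oppLR -mulNr opprK => /eqP.
rewrite -/(g t) => ->.
move: cI; rewrite in_itv/= => /andP[tc cM].
have c0 : 0 < c := lt_le_trans t0 tc.
have u0 : 0 <= 1 - c / M by rewrite subr_ge0 ler_pdivrMr// mul1r.
rewrite ger0_norm; last by rewrite mulr_ge0 ?subr_ge0// divr_ge0 ?exprn_ge0 ?(ltW c0).
have ur : (1 - c / M) ^+ n <= r ^+ n.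
  rewrite lerXn2r ?nnegrE// lerD2l lerN2 ler_pM2r ?invr_gt0//.
  exact: le_trans tc.
apply: (@le_lt_trans _ _ (r ^+ n / m * (M - m + 1))).
  apply: ler_pM; rewrite ?subr_ge0 ?divr_ge0 ?exprn_ge0 ?(ltW c0)//; last by lra.
  apply: ler_pM; rewrite ?exprn_ge0 ?invr_ge0 ?(ltW c0)// lef_pV2 ?posrE//.
  exact: le_trans tc.
by rewrite mulrAC ltr_pdivrMr// -ltr_pdivlMr.
Qed.

End LogApproximation.

Lemma max_ln_spread {R : realType} (m M t : R) : 0 < m -> m <= t -> t <= M ->
  `|ln t| <= Num.max `|ln m| `|ln M|.
Proof.
move=> m0 mt tM; have t0 := lt_le_trans m0 mt; have M0 := lt_le_trans t0 tM.
have h1 : ln m <= ln t by rewrite ler_ln ?posrE.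
have h2 : ln t <= ln M by rewrite ler_ln ?posrE.
rewrite le_max; have [l0|l0] := leP 0 (ln t).
  by rewrite (ger0_norm l0) (le_trans h2 (ler_norm _)) orbT.
have m1 : ln m < 0 := le_lt_trans h1 l0.
by rewrite (ltr0_norm l0) (ltr0_norm m1) lerN2 h1.
Qed.

(** * Inverses and the location of the spectrum *)

Section Inverse.
Context {R : realType} {H : completeNormedModType R[i]}.
Implicit Types (S T : bop H).

Lemma bop_inv_eq S T : bop_is_inverse S T -> bop_inv S = T.
Proof.
move=> ST; apply: xget_unique => // U [SU US].
by rewrite -[U]mulr1 -ST.1 mulrA US mul1r.
Qed.

Lemma is_inverse_scale (a : R[i]) S T : a != 0 ->
  bop_is_inverse S T -> bop_is_inverse (a *: S) (a^-1 *: T).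
Proof.
move=> a0 [ST TS]; split.
  by rewrite bop_scaleAl bop_scaleAr ST scalerA divff// scale1r.
by rewrite bop_scaleAl bop_scaleAr TS scalerA mulVf// scale1r.
Qed.

Lemma invertible_scale (a : R[i]) S : a != 0 ->
  bop_invertible S -> bop_invertible (a *: S).
Proof.
by move=> a0 [T ST]; exists (a^-1 *: T); exact: is_inverse_scale.
Qed.

(** Outside this ball S - t = - (t - c) (1 - U), where U = (S - c) / (t - c) has norm less than 1.
    The centre [c] is left free, to be a midpoint or the value of a scalar operator. *)
Lemma spectrum_ball S (c t : R) :
  spectrum S t%:C -> `|t - c| <= opnorm (S - c%:C *: (1 : bop H)).
Proof.
move=> St; rewrite leNgt; apply/negP => ltc; apply: St.
have tc0 : t - c != 0 by rewrite -normr_gt0 (le_lt_trans (opnorm_ge0 _) ltc).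
pose U : bop H := (t - c)^-1%:C *: (S - c%:C *: (1 : bop H)).
have -> : S - t%:C *: (1 : bop H) = (- (t - c))%:C *: (1 - U).
  rewrite scalerBr /U scalerA -rmorphM mulNr divff// rmorphN rmorph1 scaleN1r.
  rewrite opprK rmorphN rmorphB/= scaleNr scalerBl opprB.
  by rewrite addrAC addrCA subrr addr0 addrC.
apply: invertible_scale; first by rewrite -[0]/(0%:C) (inj_eq (@complexI R)) oppr_eq0.
apply: neumann_series.
by rewrite /U opnormZ normfV ltr_pdivrMl ?normr_gt0// mulr1.
Qed.

End Inverse.

(** * Positive invertible operators *)

Section PositiveInvertible.
Local Open Scope classical_set_scope.
Local Open Scope ring_scope.
Context {R : realType} {H : completeNormedModType R[i]}.
Context (dot : {dot H for Num.conj}).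
Hypothesis norm_dot : forall x : H, `|x| ^+ 2 = dot x x.
Context (x0 : H) (x00 : x0 != 0).

(** For t < 0 the cross term - 2 t (Sx, x) in |(S - t) x|^2 is nonnegative, so - t is a lower
    bound. *)
Lemma positive_approx_spectrum_ge0 (S : bop H) t :
  positive_op dot S -> approx_spectrum S t -> 0 <= t.
Proof.
move=> S0; rewrite leNgt => St; apply/negP => t0; apply: St.
exists (- t) => [|x]; first by rewrite oppr_gt0.
rewrite -(@ler_pXn2r _ 2)// ?nnegrE ?mulr_ge0 ?nrm_ge0 ?oppr_ge0 ?(ltW t0)//.
have hS := positive_selfadjoint dot S S0.
have Sx : dot (S x) x = (complex.Re (dot (S x) x))%:C.
  by rewrite RRe_real// ger0_real.
have Sx0 : 0 <= complex.Re (dot (S x) x) by rewrite -lecR -Sx.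
have -> : nrm ((S - t%:C *: (1 : bop H)) x) ^+ 2 =
    nrm (S x) ^+ 2 + t ^+ 2 * nrm x ^+ 2 - 2 * t * complex.Re (dot (S x) x).
  apply: complexI; rewrite !bopE (nrmB_sqr dot norm_dot) !(dotZl, dotZr) conj_real.
  rewrite -(hS x x) Sx !(dot_nrm dot norm_dot).
  by rewrite -!rmorphM -!rmorphD -rmorphB; congr (_%:C); ring.
have h1 : 0 <= nrm (S x) ^+ 2 by rewrite sqr_ge0.
have h2 : 0 <= - t * complex.Re (dot (S x) x) by rewrite mulr_ge0// oppr_ge0 ltW.
by rewrite exprMn sqrrN; lra.
Qed.

Lemma positive_approx_spectrum_norm (S : bop H) :
  positive_op dot S -> approx_spectrum S (opnorm S).
Proof.
move=> S0; have hS := positive_selfadjoint dot S S0.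
have [t tS] := approx_spectrum_poly_norm dot norm_dot 'X S x0 x00 hS.
have t0 := positive_approx_spectrum_ge0 S t S0 tS.
by rewrite poly_opX hornerX (ger0_norm t0) => <-.
Qed.

Context (A B : bop H) (A0 : positive_op dot A) (AB : bop_is_inverse A B).
Let M := opnorm A.
Let m := (opnorm B)^-1.

Lemma inverse_norm_gt0 : 0 < opnorm B.
Proof.
rewrite lt_def opnorm_ge0 andbT; apply: contra_neq x00 => /opnorm_eq0 B0.
by have := congr1 (fun S : bop H => S x0) AB.1; rewrite B0 mulr0 bop1 => <-.
Qed.

(** With z = B y, the form (B y, y) becomes (z, A z) = (A z, z). *)
Lemma inverse_positive : positive_op dot B.
Proof.
move=> y; have <- : A (B y) = y by rewrite -bopM AB.1.
by rewrite -bopM AB.2 bop1 -(positive_selfadjoint dot A A0).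
Qed.

Lemma approx_spectrum_bounds t : approx_spectrum A t -> m <= t <= M.
Proof.
move=> At; have t0 := positive_approx_spectrum_ge0 A t A0 At.
apply/andP; split.
  rewrite leNgt; apply/negP => tm; apply: At.
  exists (m - t) => [|x]; first by rewrite subr_gt0.
  rewrite !bopE (le_trans _ (ler_nrmB _ _))// nrmZ ger0_norm// mulrBl lerB//.
  rewrite /m ler_pdivrMl ?inverse_norm_gt0//.
  have {1}<- : B (A x) = x by rewrite -bopM AB.2.
  exact: opnorm_ub.
have := approx_spectrum_poly_le 'X A t At.
by rewrite poly_opX hornerX (ger0_norm t0).
Qed.

Lemma approx_spectrum_max : approx_spectrum A M.
Proof. exact: positive_approx_spectrum_norm. Qed.

(** As B - |B| = - |B| B (A - m), with |B| the norm of [B], a lower bound for A - m would give one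
    for B - |B|. But [B] is positive, so |B| lies in its approximate spectrum. *)
Lemma approx_spectrum_min : approx_spectrum A m.
Proof.
move=> hA; apply: (positive_approx_spectrum_norm B inverse_positive).
have b0 := inverse_norm_gt0.
have -> : B - (opnorm B)%:C *: (1 : bop H) =
    ((- opnorm B)%:C *: (1 : bop H)) * (B * (A - m%:C *: (1 : bop H))).
  rewrite mulrBr AB.2 bop_scaleAr mulr1 bop_scaleAl mul1r scalerBr scalerA.
  rewrite -rmorphM mulNr divff ?gt_eqF// !rmorphN rmorph1 scaleN1r opprK.
  by rewrite scaleNr addrC.
apply: bounded_belowM.
  apply: bounded_below_scalar.
  by rewrite -[0]/(0%:C) (inj_eq (@complexI R)) oppr_eq0 gt_eqF.
apply: bounded_belowM => //; apply: invertible_bounded_below.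
by exists A; split; [exact: AB.2|exact: AB.1].
Qed.

Lemma min_le_max : m <= M.
Proof. by have /andP[] := approx_spectrum_bounds _ approx_spectrum_max. Qed.

Lemma min_gt0 : 0 < m. Proof. by rewrite invr_gt0 inverse_norm_gt0. Qed.

Lemma approx_spectrum_sub t : approx_spectrum A t -> spectrum A t%:C.
Proof. by move=> At /invertible_bounded_below. Qed.

(* A - (m + M) / 2 has norm at most (M - m) / 2. *)
Lemma spectrum_bounds t : spectrum A t%:C -> m <= t <= M.
Proof.
pose c := (m + M) / 2.
move=> /(spectrum_ball A c).
have hA := positive_selfadjoint dot A A0.
have [s sA] := approx_spectrum_poly_norm dot norm_dot ('X - c%:P) A x0 x00 hA.
rewrite poly_opB poly_opX poly_opC !hornerE => <-.
have /andP[] := approx_spectrum_bounds s sA.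
move=> ms sM tc.
have {tc}: `|t - c| <= (M - m) / 2.
  by rewrite (le_trans tc)// ler_norml /c; apply/andP; split; lra.
by rewrite ler_norml /c => /andP[? ?]; apply/andP; split; lra.
Qed.

Lemma funcalc_log_exists : exists T, is_funcalc (@ln R) A T.
Proof.
have [m0 mM] := (min_gt0, min_le_max).
have hA := positive_selfadjoint dot A A0.
have approx := ln_poly_approx m M m0 mM.
have [|T cT] := opnorm_complete (fun n => poly_op (ln_poly M n) A).
  move=> e e0; have e2 : 0 < e / 2 by rewrite divr_gt0.
  have [N _ hN] := approx _ e2; exists N => n k /hN/= hn /hN/= hk.
  rewrite -poly_opB.
  have [t tA <-] := approx_spectrum_poly_norm dot norm_dot
    (ln_poly M n - ln_poly M k) A x0 x00 hA.
  have tmM := approx_spectrum_bounds t tA.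
  rewrite hornerD hornerN.
  rewrite -(subrKA (ln t)) (le_trans (ler_normD _ _))//.
  rewrite [leRHS]splitr lerD// ltW ?hn//.
  by rewrite -normrN opprB hk.
exists T, (ln_poly M); split => // e /approx; apply: filterS => n hn t.
by move=> /spectrum_bounds; exact: hn.
Qed.

(** Stated for any limit [T], as [xget] picks an unspecified one. Above, the norm of p_n(A) is some
    |p_n(t)| with t in [m, M]; below, m and M themselves are points of the approximate spectrum. *)
Lemma funcalc_log_norm T : is_funcalc (@ln R) A T ->
  opnorm T = Num.max `|ln m| `|ln M|.
Proof.
move=> [p [hp pT]]; have m0 := min_gt0.
have hA := positive_selfadjoint dot A A0.
have pn : opnorm (poly_op (p n) A) @[n --> \oo] --> opnorm T.
  apply/cvgrPdist_le => e e0.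
  move/cvgr0Pnorm_le : pT => /(_ _ e0); apply: filterS => n.
  rewrite ger0_norm ?opnorm_ge0//; apply: le_trans.
  by rewrite opnorm_distC ler_opnormB.
apply/eqP; rewrite eq_le; apply/andP; split.
  apply/ler_addgt0Pr => e e0; apply: (cvgr_to_le pn).
  apply: filterS (hp _ e0) => n hn.
  have [t tA <-] := approx_spectrum_poly_norm dot norm_dot (p n) A x0 x00 hA.
  have /andP[mt tM] := approx_spectrum_bounds t tA.
  rewrite -(subrK (ln t) (p n).[t]) addrC (le_trans (ler_normD _ _))// lerD//.
    exact: max_ln_spread.
  by apply/ltW/hn; exact: approx_spectrum_sub.
have low t : approx_spectrum A t -> `|ln t| <= opnorm T.
  move=> tA; apply/ler_addgt0Pr => e e0.
  have pne : opnorm (poly_op (p n) A) + e @[n --> \oo] --> opnorm T + e.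
    by apply: cvgD => //; exact: cvg_cst.
  apply: (cvgr_to_ge pne); apply: filterS (hp _ e0) => n hn.
  have := hn t (approx_spectrum_sub t tA) => /ltW h.
  rewrite -(subrK (p n).[t] (ln t)) addrC (le_trans (ler_normD _ _))// lerD//.
    exact: approx_spectrum_poly_le.
  by rewrite -normrN opprB.
by rewrite ge_max !low//; [exact: approx_spectrum_max|exact: approx_spectrum_min].
Qed.

Lemma op_log_norm : opnorm (op_log A) = Num.max `|ln m| `|ln M|.
Proof.
apply: funcalc_log_norm; have [T hT] := funcalc_log_exists.
exact: (xgetPex 0 (P := [set T | is_funcalc (@ln R) A T]) (ex_intro _ T hT)).
Qed.

End PositiveInvertible.

(** * Scalar operators, rays and the Thompson metric *)

Section Rays.
Local Open Scope classical_set_scope.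
Local Open Scope ring_scope.
Context {R : realType} {H : completeNormedModType R[i]}.

(** The spectrum of c I is the single point c, so p_n(c) tends to f(c) for every admissible
    sequence, which pins down the limit. *)
Lemma funcalc_scalar (f : R -> R) (c : R) (x0 : H) : x0 != 0 ->
  funcalc f (c%:C *: (1 : bop H)) = (f c)%:C *: (1 : bop H).
Proof.
move=> x00; apply: xget_unique => [|T [p [hp pT]]].
  exists (fun=> (f c)%:P); split; last first.
    by under eq_fun do rewrite poly_opC subrr opnorm0; exact: cvg_cst.
  move=> e e0; apply: nearW => n t /(spectrum_ball _ c).
  rewrite subrr opnorm0 normr_le0 subr_eq0 => /eqP ->.
  by rewrite hornerC subrr normr0.
have cS : spectrum (c%:C *: (1 : bop H)) c%:C.
  rewrite /spectrum/= subrr => -[U [_ U0]]; move: x00.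
  have := congr1 (fun S : bop H => S x0) U0.
  by rewrite mulr0 bop0 bop1 => <-; rewrite eqxx.
apply/eqP; rewrite -subr_eq0; apply/eqP/opnorm_eq0/eqP.
rewrite eq_le opnorm_ge0 andbT; apply/ler_addgt0Pr => e e0; rewrite add0r.
have pTe : opnorm (poly_op (p n) (c%:C *: (1 : bop H)) - T) + e @[n --> \oo] --> 0 + e.
  by apply: cvgD => //; exact: cvg_cst.
rewrite add0r in pTe; apply: (cvgr_to_ge pTe).
apply: filterS (hp _ e0) => n /(_ _ cS) /ltW h.
rewrite poly_op_scalar; set U := (p n).[c]%:C *: _.
rewrite -(subrKA U) (le_trans (opnormD _ _))// opnorm_distC lerD//.
by rewrite /U -scalerBl -rmorphB opnormZ (opnorm1 _ x00) mulr1.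
Qed.

Lemma ray_reprP (S : bop H) :
  exists2 a : R, 0 < a & ray_repr (ray S) = a%:C *: S.
Proof.
have [a a0 aS] : ray S (ray_repr (ray S)).
  by apply: (xgetPex 0 (P := ray S)); exists (1%:C *: S), 1 => //=; rewrite ltr01.
by exists a.
Qed.

Context (dot : {dot H for Num.conj}).
Hypothesis norm_dot : forall x : H, `|x| ^+ 2 = dot x x.

Lemma op_log_scale_norm (x0 : H) (A B : bop H) (s : R) : x0 != 0 ->
  positive_op dot A -> bop_is_inverse A B -> 0 < s ->
  opnorm (op_log (s%:C *: A)) =
    Num.max `|ln s - ln (opnorm B)| `|ln s + ln (opnorm A)|.
Proof.
move=> x00 A0 AB s0.
have sA0 : positive_op dot (s%:C *: A).
  by move=> x; rewrite bopZ dotZl mulr_ge0// ?lecR ?ltW// ltcR.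
have sC0 : s%:C != 0 by rewrite -[0]/(0%:C) (inj_eq (@complexI R)) gt_eqF.
have sAB := is_inverse_scale s%:C A B sC0 AB.
have b0 := inverse_norm_gt0 x0 x00 A B AB.
have a0 := inverse_norm_gt0 x0 x00 B A (conj AB.2 AB.1).
rewrite (op_log_norm dot norm_dot x0 x00 _ _ sA0 sAB).
rewrite -fmorphV !opnormZ normfV (gtr0_norm s0).
by rewrite invfM invrK ln_div ?posrE// lnM ?posrE.
Qed.

Lemma thompson_scalar_scale_norm (x0 : H) (A B : bop H) (c l : R) : x0 != 0 ->
  positive_op dot A -> bop_is_inverse A B -> 0 < c -> 0 < l ->
  thompson (c%:C *: (1 : bop H)) (l%:C *: A) =
    Num.max `|ln (l / c) - ln (opnorm B)| `|ln (l / c) + ln (opnorm A)|.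
Proof.
move=> x00 A0 AB c0 l0.
have lc0 : 0 < l / c by rewrite divr_gt0.
rewrite -(op_log_scale_norm x0 A B _ x00 A0 AB lc0).
rewrite /thompson /op_invsqrt (funcalc_scalar _ _ x0 x00).
set k := c `^ _; congr (opnorm (op_log _)).
apply: bopP => x; rewrite !bopE !bop_scale !scalerA.
rewrite -!rmorphM; congr (_%:C *: _).
transitivity (l * (k * k)); first by ring.
congr (l * _); rewrite /k -powRD; last by rewrite (gt_eqF c0) implybT.
rewrite (_ : - 2^-1 + - 2^-1 = -1); last by lra.
by rewrite powR_inv1 ?ltW.
Qed.

End Rays.

Theorem theorem3p1 (R : realType) (H : completeNormedModType R[i])
    (dot : {dot H for Num.conj})
    (norm_dot : forall x : H, `|x| ^+ 2 = dot x x)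
    (A : bop H) (hA : pos_invertible dot A) :
  proj_thompson (ray (1 : bop H)) (ray A) = 2^-1 * ln (kappa A).
Proof.
have [A0 [B AB]] := hA.
rewrite /proj_thompson /kappa (bop_inv_eq _ _ AB).
set E := (X in inf X).
have [[x0 x00]|trivH] := pselect (exists x : H, x != 0); last first.
  (* In the zero space both sides vanish, as kappa A = 0 and ln 0 = 0. *)
  have norm0 (S : bop H) : opnorm S = 0.
    have -> : S = 0; last exact: opnorm0.
    apply: bopP => x; apply/eqP/negPn/negP => Sx; apply: trivH.
    by exists (S x).
  have -> : E = [set 0]%classic.
    rewrite predeqE => r; split => [[l _ <-]|->]; first exact: norm0.
    by exists 1; [exact: ltr01|exact: norm0].
  by rewrite inf1 norm0 mul0r ln0// mulr0.
have b0 := inverse_norm_gt0 x0 x00 A B AB.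
have a0 := inverse_norm_gt0 x0 x00 B A (conj AB.2 AB.1).
(* From here on [m] is the logarithm of the norm of the inverse, hence minus the logarithm of the
   least point of the approximate spectrum. *)
rewrite lnM ?posrE//; set M := ln (opnorm A); set m := ln (opnorm B).
have [c c0 cE] := ray_reprP (1 : bop H); have [a ap aE] := ray_reprP A.
have thE l : 0 < l -> thompson (ray_repr (ray (1 : bop H)))
    (l%:C *: ray_repr (ray A)) =
    Num.max `|ln (l * a / c) - m| `|ln (l * a / c) + M|.
  move=> l0; rewrite cE aE scalerA -rmorphM.
  by rewrite (thompson_scalar_scale_norm dot norm_dot x0 A B)// mulr_gt0.
(* The numbers s + M and s - m differ by M + m, so one of them has absolute value at least half of
   that. *)
have lbE : lbound E (2^-1 * (M + m)).
  move=> _ [l l0 <-]; rewrite thE//; set s := ln _.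
  rewrite le_max; have [h|h] := leP (2^-1 * (M + m)) `|s - m|; first by [].
  move: h; rewrite ltr_norml => /andP[h1 h2].
  by apply: le_trans (ler_norm _); lra.
apply/eqP; rewrite eq_le; apply/andP; split; last first.
  by apply: lb_le_inf => //; exists (thompson (ray_repr (ray (1 : bop H)))
    (1%:C *: ray_repr (ray A))), 1 => //=; rewrite ltr01.
(* Chosen so that s = ln (l a / c) is (m - M) / 2, where s - m and s + M are opposite; c / a undoes
   the choice of representatives. *)
pose l := expR ((m - M) / 2) * c / a.
have l0 : 0 < l by rewrite divr_gt0// mulr_gt0// expR_gt0.
apply: ge_inf; first by exists (2^-1 * (M + m)).
exists l => //; rewrite thE// /l divfK ?gt_eqF// mulfK ?gt_eqF// expRK.
rewrite (_ : _ - m = - (2^-1 * (M + m))); last by lra.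
rewrite (_ : _ + M = 2^-1 * (M + m)); last by lra.
(* M + m >= 0 because the condition number is at least 1, by submultiplicativity applied to A B =
   1. *)
rewrite normrN maxxx ger0_norm// mulr_ge0 ?invr_ge0// -lnM ?posrE// ln_ge0//.
by rewrite -(opnorm1 _ x00) -AB.1 opnormM.
Qed.
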